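(* Let $F$ be a nonbipartite graph with vertex set $\{x_1,\dots,x_n\}$, $n\ge 3$, and let $\lambda_1,\dots,\lambda_m$ be the distinct eigenvalues of $A_F$ with multiplicities $m_1,\dots,m_m$. Let $G_F$ be the graph on $\{x_1,\dots,x_n\}\cup\{y_1,\dots,y_n\}$ in which $x_i\sim y_k$ iff $x_i\sim x_k$ in $F$ and there are no other edges (so $G_F=F\times K_2$), and let $H_F$ be the graph on the same vertex set consisting of a copy of $F$ on $\{x_i\}$ and a copy of $F$ on $\{y_i\}$ (via $x_i\mapsto y_i$), with no edges between them (so $H_F=2F$). For $1\le j\le n$ let $S=\{x_1,\dots,x_j\}\cup\{y_1,\dots,y_j\}$, let $G^v_{F,j}$ be obtained from $G_F$ by adding a new vertex $v$ adjacent exactly to the vertices of $S$, and let $H^w_{F,j}$ be obtained from $H_F$ by adding a new vertex $w$ adjacent exactly to the vertices of $S$. Then there exist real numbers $\rho_1,\dots,\rho_m$ such that $$P_{H^w_{F,j}}(x)=\prod_{i=1}^m(x-\lambda_i)^{2m_i-1}\Bigl(x\prod_{i=1}^m(x-\lambda_i)-\sum_{i=1}^m\rho_i^2\prod_{l\ne i}(x-\lambda_l)\Bigr)$$ and $$P_{G^v_{F,j}}(x)=\prod_{i=1}^m(x-\lambda_i)^{m_i-1}\prod_{i=1}^m(x+\lambda_i)^{m_i}\Bigl(x\prod_{i=1}^m(x-\lambda_i)-\sum_{i=1}^m\rho_i^2\prod_{l\ne i}(x-\lambda_l)\Bigr).$$ In particular, $G^v_{F,j}$ and $H^w_{F,j}$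 are singularly cospectral but not cospectral.
   Context: All graphs are finite and simple; $A_F$ is the adjacency matrix of $F$ and $P_X(x)=\det(xI-A_X)$ is the characteristic polynomial of a graph $X$. Two graphs are cospectral if their adjacency matrices have the same spectrum; the singular values of a graph are those of its adjacency matrix, and two graphs are singularly cospectral if they have the same nonzero singular values with the same multiplicities. *)

(* Defs.v *)
From HB Require Import structures.
From mathcomp Require Import all_boot all_order all_algebra.
From mathcomp Require Import reals.

Set Implicit Arguments.
Unset Strict Implicit.
Unset Printing Implicit Defensive.

Import Order.TTheory GRing.Theory Num.Theory.
Local Open Scope ring_scope.

Record sgraph (V : finType) := SGraph {
  adj :> rel V;
  adj_sym : symmetric adj;
  adj_irr : irreflexive adj
}.

Definition bipartite (V : finType) (X : sgraph V) : Prop :=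
  exists A : {set V}, forall u v, X u v -> (u \in A) != (v \in A).

Definition adjmx (R : realType) (V : finType) (X : sgraph V) : 'M[R]_#|V| :=
  \matrix_(i, j) (X (enum_val i) (enum_val j))%:R.

Definition graph_poly (R : realType) (V : finType) (X : sgraph V) : {poly R} :=
  char_poly (adjmx R X).

(* Multiplicity of a as an eigenvalue of A (0 if a is not an eigenvalue). *)
Definition eig_mult (R : realType) (n : nat) (A : 'M[R]_n) (a : R) : nat :=
  mup a (char_poly A).

(* The singular values are the nonnegative square roots of the eigenvalues of
   A^T *m A; the multiplicity is 0 if s is not a singular value. *)
Definition sing_mult (R : realType) (n : nat) (A : 'M[R]_n) (s : R) : nat :=
  if 0 <= s then eig_mult (A^T *m A) (s ^+ 2) else 0%N.

(* Adjacency matrices are real symmetric, so their spectrum is the multiset of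
   their eigenvalues in R. *)
Definition cospectral (R : realType) (V W : finType)
    (X : sgraph V) (Y : sgraph W) : Prop :=
  forall a : R, eig_mult (adjmx R X) a = eig_mult (adjmx R Y) a.

Definition singularly_cospectral (R : realType) (V W : finType)
    (X : sgraph V) (Y : sgraph W) : Prop :=
  forall s : R, s != 0 -> sing_mult (adjmx R X) s = sing_mult (adjmx R Y) s.

(* In V + V, inl is the copy x of the vertices and inr the copy y. *)
Section Constructions.
Variables (V : finType) (F : sgraph V).

Definition double_cover_rel : rel (V + V)%type := fun u v =>
  match u, v with
  | inl a, inr b => F a b
  | inr b, inl a => F a b
  | _, _ => false
  end.

Lemma double_cover_sym : symmetric double_cover_rel.
Proof. by move=> [a|a] [b|b]. Qed.

Lemma double_cover_irr : irreflexive double_cover_rel.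
Proof. by move=> [a|a]. Qed.

Definition double_cover : sgraph (V + V)%type :=
  SGraph double_cover_sym double_cover_irr.

Definition two_copies_rel : rel (V + V)%type := fun u v =>
  match u, v with
  | inl a, inl b => F a b
  | inr a, inr b => F a b
  | _, _ => false
  end.

Lemma two_copies_sym : symmetric two_copies_rel.
Proof. by move=> [a|a] [b|b] //=; rewrite adj_sym. Qed.

Lemma two_copies_irr : irreflexive two_copies_rel.
Proof. by move=> [a|a] /=; rewrite adj_irr. Qed.

Definition two_copies : sgraph (V + V)%type :=
  SGraph two_copies_sym two_copies_irr.

Variable S : {set V}.

(* None is the new vertex. *)
Definition add_vertex_rel : rel (option V) := fun u v =>
  match u, v with
  | Some a, Some b => F a b
  | Some a, None => a \in S
  | None, Some b => b \in S
  | None, None => false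
  end.

Lemma add_vertex_sym : symmetric add_vertex_rel.
Proof. by move=> [a|] [b|] //=; rewrite adj_sym. Qed.

Lemma add_vertex_irr : irreflexive add_vertex_rel.
Proof. by move=> [a|] //=; rewrite adj_irr. Qed.

Definition add_vertex : sgraph (option V) :=
  SGraph add_vertex_sym add_vertex_irr.

End Constructions.

(* Indices start at 0: the ordinal i stands for the vertices x_(i+1), y_(i+1). *)
Definition first_pairs (n j : nat) : {set 'I_n + 'I_n} :=
  [set u : 'I_n + 'I_n | match u with inl i => i < j | inr i => i < j end]%N.

Definition Gv (n : nat) (F : sgraph 'I_n) (j : nat) :
    sgraph (option ('I_n + 'I_n)) :=
  add_vertex (double_cover F) (first_pairs n j).

Definition Hw (n : nat) (F : sgraph 'I_n) (j : nat) :
    sgraph (option ('I_n + 'I_n)) :=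
  add_vertex (two_copies F) (first_pairs n j).

(* Main.v *)
Require Import Defs.
From HB Require Import structures.
From mathcomp Require Import all_boot all_order all_algebra all_fingroup.
From mathcomp Require Import reals.
From mathcomp Require Import complex spectral ring.

(* Let A be the adjacency matrix of F, s the indicator of the first j vertices
   and B the bordered matrix [[0, 2 s^T], [s, A]]. Splitting R^V + R^V into
   its diagonal and a complement makes both extended graphs block triangular:
   P_H = P_A P_B and P_G = P_(-A) P_B. Unitary diagonalisation of A over R[i]
   expands P_B as x prod_k (x - d_k) - 2 sum_k |t_k|^2 prod_(l != k) (x - d_l),
   and grouping equal eigenvalues gives the two formulas.
   Since P_(M^2)(x^2) = P_M(x) P_(-M)(x), the two adjacency matrices have squares
   with the same characteristic polynomial. If the graphs were cospectral, the
   spectrum of A would be symmetric about 0, so all odd powers of A would have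
   trace 0: F would have no closed walk of odd length, hence be bipartite. *)

Set Implicit Arguments.
Unset Strict Implicit.
Unset Printing Implicit Defensive.

Import Order.TTheory GRing.Theory Num.Theory.
Local Open Scope ring_scope.

(** * Characteristic polynomials under reindexing, similarity and bordering *)

(** The bijection forces p = q and becomes a permutation of both rows and columns, so its sign
    enters squared. *)
Lemma char_poly_reindex (K : comNzRingType) p q (A : 'M[K]_p) (B : 'M[K]_q)
    (f : 'I_p -> 'I_q) :
  bijective f -> (forall i j, A i j = B (f i) (f j)) ->
  char_poly A = char_poly B.
Proof.
move=> bij_f AB.
have Epq : p = q by rewrite -(card_ord p) -(card_ord q) (bij_eq_card bij_f).
subst q; pose s := perm (bij_inj bij_f).
have -> : char_poly A = \det (row_perm s (col_perm s (char_poly_mx B))).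
  congr (\det _); apply/matrixP=> i j; rewrite !mxE AB !permE.
  by rewrite (inj_eq (bij_inj bij_f)).
rewrite row_permE col_permE !det_mulmx !det_perm mulrCA odd_permV.
by rewrite -expr2 sqrr_sign mulr1.
Qed.

Lemma char_poly_similar (K : fieldType) n (P A B : 'M[K]_n) :
  P \in unitmx -> P *m A = B *m P -> char_poly A = char_poly B.
Proof.
move=> uP PA; pose Q := map_mx (@polyC K) P.
have E : Q *m char_poly_mx A = char_poly_mx B *m Q.
  rewrite /char_poly_mx mulmxBr mulmxBl -!map_mxM PA.
  by rewrite mul_mx_scalar mul_scalar_mx.
have Q0 : \det Q != 0 by rewrite det_map_mx polyC_eq0 -unitfE -unitmxE.
apply: (mulfI Q0); rewrite /char_poly -det_mulmx E det_mulmx.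
exact: mulrC.
Qed.

Lemma char_poly_ublock (K : comNzRingType) p q (A : 'M[K]_p) (B : 'M[K]_(p, q))
    (C : 'M[K]_q) :
  char_poly (block_mx A B 0 C) = char_poly A * char_poly C.
Proof.
rewrite /char_poly /char_poly_mx map_block_mx scalar_mx_block opp_block_mx.
by rewrite add_block_mx map_mx0 oppr0 addr0 det_ublock.
Qed.

Lemma char_polyN (K : comNzRingType) n (A : 'M[K]_n) :
  char_poly (- A) = (-1) ^+ n * (char_poly A \Po - 'X).
Proof.
rewrite /char_poly -[_ \Po _]/(comp_poly (- 'X) _) -det_map_mx -detZ.
congr (\det _).
apply/matrixP=> i j; rewrite !mxE rmorphB rmorphMn /= comp_polyX comp_polyC.
by rewrite mulN1r opprB polyCN opprK mulNrn addrC opprK.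
Qed.

Lemma char_poly_diag (K : comNzRingType) n (d : 'rV[K]_n) :
  char_poly (diag_mx d) = \prod_k ('X - (d 0 k)%:P).
Proof.
rewrite char_poly_trig ?diag_mx_is_trig //.
by apply: eq_bigr => k _; rewrite mxE eqxx.
Qed.

(** Elimination would divide by X - d_k. Scaling by the product [p] avoids fractions: [w k] plays
    the role of p / (X - d_k), and [p], being monic, is cancelled at the end. *)
Lemma char_poly_bordered_diag (K : idomainType) n (d : 'rV[K]_n) (r : 'rV[K]_n)
    (c : 'cV[K]_n) :
  char_poly (block_mx 0 r c (diag_mx d) : 'M_(1 + n)) =
    'X * \prod_k ('X - (d 0 k)%:P)
    - \sum_k (r 0 k * c k 0) *: \prod_(l | l != k) ('X - (d 0 l)%:P).
Proof.
set p := \prod_k _; pose w k := \prod_(l | l != k) ('X - (d 0 l)%:P).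
have wE k : ('X - (d 0 k)%:P) * w k = p by rewrite /p (bigD1 k).
have p0 : p != 0 by rewrite /p -char_poly_diag monic_neq0 ?char_poly_monic.
(* Right multiplication by [T] clears the first column below its top entry. *)
pose T : 'M_(1 + n) := block_mx p%:M 0 (\col_k ((c k 0)%:P * w k)) 1%:M.
pose M := char_poly_mx (block_mx 0 r c (diag_mx d) : 'M_(1 + n)).
have EM : M = block_mx ('X%:M) (- map_mx polyC r) (- map_mx polyC c)
                       (char_poly_mx (diag_mx d)).
  rewrite /M /char_poly_mx map_block_mx scalar_mx_block opp_block_mx.
  by rewrite add_block_mx map_mx0 oppr0 !add0r addr0.
have MT : M *m T = block_mx
   ('X * p - \sum_k (r 0 k * c k 0) *: w k)%:M (- map_mx polyC r)
   0 (char_poly_mx (diag_mx d)).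
  rewrite EM mulmx_block !mulmx0 !mulmx1 !add0r; congr block_mx.
  - apply/matrixP=> i j; rewrite !ord1 -scalar_mxM !mxE eqxx mulr1n; congr (_ + _).
    rewrite -sumrN; apply: eq_bigr => k _.
    by rewrite !mxE mulNr mulrA -polyCM mul_polyC.
  - apply/matrixP=> i j; rewrite !ord1 mul_mx_scalar !mxE.
    rewrite (bigD1 i) //= big1 => [|l nli].
      rewrite !mxE eqxx !mulr1n addr0 mulrCA wE mulrC mulNr.
      by rewrite mulrC addNr.
    by rewrite !mxE eq_sym (negPf nli) !mulr0n subrr mul0r.
apply: (mulIf p0).
have -> : char_poly (block_mx 0 r c (diag_mx d) : 'M_(1 + n)) * p = \det (M *m T).
  by rewrite det_mulmx det_lblock det1 mulr1 det_scalar1.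
by rewrite MT det_ublock det_scalar1 -[\det _]/(char_poly _) char_poly_diag.
Qed.

(** * Traces of powers and diagonalisation of real symmetric matrices *)

Lemma mxtrace_expr_similar (K : fieldType) n (P A D : 'M[K]_n) k :
  P \in unitmx -> P *m A = D *m P -> \tr (A ^+ k) = \tr (D ^+ k).
Proof.
move=> uP PA.
have PAk : P *m A ^+ k = D ^+ k *m P.
  elim: k => [|k IHk]; first by rewrite !expr0 mul1mx mulmx1.
  by rewrite !exprSr -!mulmxE mulmxA IHk -!mulmxA PA.
by rewrite -[D ^+ k](mulmxK uP) -PAk mxtrace_mulC mulKmx.
Qed.

Lemma mxtrace_expr_diag (K : comNzRingType) n (d : 'rV[K]_n) k :
  \tr (diag_mx d ^+ k) = \sum_i d 0 i ^+ k.
Proof.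
have -> : diag_mx d ^+ k = diag_mx (\row_i d 0 i ^+ k).
  elim: k => [|k IHk].
    by apply/matrixP=> i j; rewrite !mxE.
  rewrite exprS IHk -mulmxE mulmx_diag; congr diag_mx.
  by apply/rowP=> i; rewrite !mxE exprS.
by rewrite mxtrace_diag; apply: eq_bigr => i _; rewrite mxE.
Qed.

(** The three conclusions share one list [d] of real eigenvalues. The number [t k] is the modulus of
    the k-th coordinate of [s] in a unitary eigenbasis over R[i]; only this modulus matters, so the
    result is real. *)
Lemma sym_spectral (R : rcfType) n (A : 'M[R]_n) (s : 'cV[R]_n) (c : R) :
  A^T = A -> exists d t : 'I_n -> R,
  [/\ char_poly A = \prod_k ('X - (d k)%:P),
      char_poly (block_mx 0 (c *: s^T) s A : 'M_(1 + n)) =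
        'X * \prod_k ('X - (d k)%:P)
        - \sum_k (c * t k ^+ 2) *: \prod_(l | l != k) ('X - (d l)%:P) &
      forall k, \tr (A ^+ k) = \sum_i d i ^+ k].
Proof.
move=> symA; pose f : {rmorphism R -> R[i]} := real_complex R.
have f_inj : injective (map_poly f) := map_poly_inj f.
pose Ac := map_mx f A; pose U := spectralmx Ac; pose D := spectral_diag Ac.
have hermA : Ac \is hermsymmx.
  apply: realsym_hermsym.
    by apply/is_hermitianmxP; rewrite expr0 scale1r map_mx_id // map_trmx symA.
  by apply/mxOverP=> i j; rewrite mxE; apply/complex_realP; exists (A i j).
have uU : U \in unitmx := spectral_unit Ac.
have UA : U *m Ac = diag_mx D *m U.
  have /hermitian_normalmx/orthomx_spectralP -> := hermA.
  by rewrite !mulmxA mulmxV // mul1mx.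
have DE k : D 0 k = f (complex.Re (D 0 k)).
  by apply/esym/RRe_real/(mxOverP (hermitian_spectral_diag_real hermA)).
pose d k := complex.Re (D 0 k).
pose u := U *m map_mx f s.
pose r := map_mx f (c *: s^T) *m invmx U.
(* The inverse of [U] is its conjugate transpose and [s] is real, so [r] is [c] times the conjugate
   of [u]. *)
have ruE k : r 0 k * u k 0 = f (c * complex.Re `|u k 0| ^+ 2).
  have -> : r 0 k = f c * (u k 0)^*.
    rewrite /r invmx_unitary ?spectral_unitarymx // map_mxZ -scalemxAl mxE.
    congr (_ * _); rewrite !mxE rmorph_sum; apply: eq_bigr => i _.
    rewrite !mxE rmorphM mulrC; congr (_ * _).
    by rewrite /= conj_Creal //; apply/complex_realP; exists (s i 0).
  by rewrite -mulrA [_^* * _]mulrC -normCK rmorphM rmorphXn.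
exists d, (fun k => complex.Re `|u k 0|); split.
- apply: f_inj; rewrite map_char_poly (char_poly_similar uU UA) char_poly_diag.
  rewrite rmorph_prod; apply: eq_bigr => k _.
  by rewrite rmorphB /= map_polyX map_polyC /= -DE.
- apply: f_inj; rewrite map_char_poly map_block_mx map_mx0.
  (* Conjugation by diag(1, U) diagonalises the corner [A] and turns the borders into [r] and
     [u]. *)
  rewrite (@char_poly_similar _ _ (block_mx 1%:M 0 0 U) _
            (block_mx 0 r u (diag_mx D))); last 2 first.
  + by rewrite unitmxE det_ublock det1 mul1r -unitmxE.
  + by rewrite !mulmx_block !(mul0mx, mulmx0, mul1mx, mulmx1, addr0, add0r)
               UA mulmxKV.
  rewrite char_poly_bordered_diag rmorphB rmorphM rmorph_prod rmorph_sum /=.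
  rewrite map_polyX; congr (_ * _ - _); apply: eq_bigr => k _.
    by rewrite rmorphB /= map_polyX map_polyC /= -DE.
  rewrite map_polyZ ruE rmorph_prod; congr (_ *: _); apply: eq_bigr => l _.
  by rewrite rmorphB /= map_polyX map_polyC /= -DE.
- move=> k; apply: (fmorph_inj f); rewrite -trace_map_mx rmorph_sum /=.
  have -> : map_mx f (A ^+ k) = Ac ^+ k by rewrite rmorphXn.
  rewrite (mxtrace_expr_similar k uU UA) mxtrace_expr_diag.
  by apply: eq_bigr => i _; rewrite rmorphXn /= -DE.
Qed.

(** * Squares of matrices and bordered doubles *)

(** Take determinants in (X - A)(X + A) = X^2 - A^2. *)
Lemma char_poly_sqr (K : comNzRingType) n (A : 'M[K]_n) :
  char_poly (A *m A) \Po 'X^2 = char_poly A * char_poly (- A).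
Proof.
rewrite /char_poly -[_ \Po _]/(comp_poly 'X^2 _) -det_map_mx -det_mulmx.
congr (\det _).
have -> : char_poly_mx (- A) = 'X%:M + map_mx polyC A.
  by rewrite /char_poly_mx map_mxN opprK.
rewrite /char_poly_mx mulmxDr !mulmxBl -scalar_mxM mul_mx_scalar mul_scalar_mx.
rewrite addrA subrK -expr2 -map_mxM.
by apply/matrixP=> i j; rewrite !mxE rmorphB rmorphMn /= comp_polyX comp_polyC.
Qed.

Lemma comp_polyXn_inj (K : comNzRingType) n :
  (0 < n)%N -> injective (fun p : {poly K} => p \Po 'X^n).
Proof.
move=> n_gt0 p q /= pq; apply/polyP=> i.
have := congr1 (fun r : {poly K} => r`_(i * n)) pq.
by rewrite /= !coef_comp_poly_Xn // dvdn_mull // mulnK.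
Qed.

Lemma char_poly_sqr_eq (K : comNzRingType) n (A B : 'M[K]_n) :
  char_poly A * char_poly (- A) = char_poly B * char_poly (- B) ->
  char_poly (A *m A) = char_poly (B *m B).
Proof.
move=> AB; apply: (@comp_polyXn_inj _ 2) => //=.
by rewrite !char_poly_sqr.
Qed.

(* Change of basis from [(x, y)] to [(x, y - x)] on the two copies. *)
Lemma char_poly_bordered_double (K : fieldType) n (A1 A2 : 'M[K]_n)
    (s : 'cV[K]_n) :
  char_poly (block_mx (block_mx 0 s^T s A1) (col_mx s^T A2)
                      (row_mx s A2) A1 : 'M_(1 + n + n)) =
  char_poly (A1 - A2) *
  char_poly (block_mx 0 (2%:R *: s^T) s (A1 + A2) : 'M_(1 + n)).
Proof.
rewrite mulrC -(char_poly_ublock _ (col_mx s^T A2)); apply/esym.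
apply: (@char_poly_similar _ _ (block_mx 1%:M 0 (row_mx 0 1%:M) 1%:M)).
  by rewrite unitmxE det_lblock !det1 mul1r unitr1.
rewrite !mulmx_block !(mul0mx, mulmx0, mul1mx, mulmx1, addr0, add0r).
rewrite mul_row_block mul_row_col mul_col_row mul_mx_row.
rewrite !(mul0mx, mulmx0, mul1mx, mulmx1, addr0, add0r).
rewrite add_block_mx add_row_mx !addr0 [A2 + (_ - _)]addrC subrK scaler_nat mulr2n.
by rewrite [A2 + A1]addrC.
Qed.

(** * Block form of the adjacency matrices of the extended graphs *)

Section GraphMatrices.
Variables (R : realType) (V : finType).
Implicit Types (F X : sgraph V) (S : {set V}).

Definition indicator S : 'cV[R]_#|V| := \col_i (enum_val i \in S)%:R.

Definition double_set S : {set V + V} :=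
  [set u : V + V | match u with inl a => a \in S | inr a => a \in S end].

(** Lists the new vertex first, then the copy x, then the copy y, to match the blocks of
    [char_poly_bordered_double]. *)
Definition double_index (u : option (V + V)) : 'I_(1 + #|V| + #|V|) :=
  match u with
  | None => lshift _ (lshift _ ord0)
  | Some (inl a) => lshift _ (rshift _ (enum_rank a))
  | Some (inr a) => rshift _ (enum_rank a)
  end.

Lemma double_index_inj : injective double_index.
Proof.
move=> [[a|a]|] [[b|b]|] //= /eqP;
  rewrite ?eq_lrshift ?eq_rlshift ?(inj_eq (@lshift_inj _ _)) ?eq_lrshift
          ?eq_rlshift ?(inj_eq (@rshift_inj _ _)) ?(inj_eq enum_rank_inj) //;
  by move/eqP=> ->.
Qed.

Lemma graph_poly_double (Y : sgraph (option (V + V)))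
    (M : 'M[R]_(1 + #|V| + #|V|)) :
  (forall u v, (Y u v)%:R = M (double_index u) (double_index v)) ->
  graph_poly R Y = char_poly M.
Proof.
move=> YM; apply: (@char_poly_reindex _ _ _ _ _ (double_index \o enum_val)).
  apply: inj_card_bij; last by rewrite !card_ord card_option card_sum addSn.
  exact: inj_comp double_index_inj enum_val_inj.
by move=> i j; rewrite mxE YM.
Qed.

(** Edges stay inside each copy: the case A1 = A, A2 = 0 of the bordered double. *)
Lemma graph_poly_two_copies F S :
  graph_poly R (add_vertex (two_copies F) (double_set S)) =
  char_poly (adjmx R F) *
  char_poly (block_mx 0 (2%:R *: (indicator S)^T) (indicator S) (adjmx R F)
             : 'M_(1 + #|V|)).
Proof.
have := char_poly_bordered_double (adjmx R F) 0 (indicator S).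
rewrite addr0 subr0 => <-; apply: graph_poly_double.
by move=> [[a|a]|] [[b|b]|] /=;
  rewrite ?(block_mxEul, block_mxEur, block_mxEdl, block_mxEdr, col_mxEu,
            col_mxEd, row_mxEl, row_mxEr) ?mxE ?enum_rankK ?inE.
Qed.

(** Edges only cross between the copies: the case A1 = 0, A2 = A, so A1 - A2 = -A while A1 + A2, and
    hence the bordered factor, is as for two copies. *)
Lemma graph_poly_double_cover F S :
  graph_poly R (add_vertex (double_cover F) (double_set S)) =
  char_poly (- adjmx R F) *
  char_poly (block_mx 0 (2%:R *: (indicator S)^T) (indicator S) (adjmx R F)
             : 'M_(1 + #|V|)).
Proof.
have := char_poly_bordered_double 0 (adjmx R F) (indicator S).
rewrite !add0r => <-; apply: graph_poly_double.
by move=> [[a|a]|] [[b|b]|] /=;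
  rewrite ?(block_mxEul, block_mxEur, block_mxEdl, block_mxEdr, col_mxEu,
            col_mxEd, row_mxEl, row_mxEr) ?mxE ?enum_rankK ?inE // adj_sym.
Qed.

Lemma tr_adjmx X : (adjmx R X)^T = adjmx R X.
Proof. by apply/matrixP=> i j; rewrite !mxE adj_sym. Qed.

Lemma adjmx_expr_ge0 X k i j : 0 <= (adjmx R X ^+ k) i j.
Proof.
elim: k i j => [|k IHk] i j; first by rewrite expr0 mxE ler0n.
by rewrite exprS -mulmxE mxE sumr_ge0 // => l _; rewrite mulr_ge0 // mxE ler0n.
Qed.

(** * Walks in the double cover and odd closed walks *)

Definition forget_side (u : V + V) : V := match u with inl a | inr a => a end.
Definition side (u : V + V) : bool := if u is inl _ then false else true.
Definition swap_side (u : V + V) : V + V :=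
  match u with inl a => inr a | inr a => inl a end.

(** Forgetting sides projects the path to a walk of the same length in [X], which makes the entry of
    the power positive; every edge of the cover changes side. *)
Lemma double_cover_path X u p : path (double_cover X) u p ->
  0 < (adjmx R X ^+ size p) (enum_rank (forget_side u))
                            (enum_rank (forget_side (last u p)))
  /\ side (last u p) = side u (+) odd (size p).
Proof.
elim: p u => [|v p IHp] u /=.
  by rewrite expr0 mxE eqxx ltr01 addbF.
case/andP=> Xuv /IHp[gt0 ->]; split; last first.
  by case: u v Xuv {IHp gt0} => [a|a] [b|b] //= _; case: odd.
have Xf : X (forget_side u) (forget_side v).
  by case: u v Xuv {IHp gt0} => [a|a] [b|b] //=; rewrite adj_sym.
rewrite exprS -mulmxE mxE (bigD1 (enum_rank (forget_side v))) //=.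
rewrite ltr_wpDr //; last by rewrite mxE !enum_rankK Xf mul1r.
by rewrite sumr_ge0 // => l _; rewrite mulr_ge0 ?adjmx_expr_ge0 // mxE ler0n.
Qed.

Lemma double_cover_connect_swap X u v :
  connect (double_cover X) u v ->
  connect (double_cover X) (swap_side u) (swap_side v).
Proof.
case/connectP=> p; elim: p u => [|w p IHp] u /=; first by move=> _ ->.
case/andP=> Xuw /IHp{}IHp /IHp; apply: connect_trans; apply: connect1.
by case: u w Xuw {IHp} => [a|a] [b|b] //=; rewrite adj_sym.
Qed.

(** A walk is lifted edge by edge. The first edge leads to the other side, so the lift of the
    remaining walk is swapped before it is appended. *)
Lemma double_cover_connect_lift X a b :
  connect X a b ->
  connect (double_cover X) (inl a) (inl b) ||
  connect (double_cover X) (inl a) (inr b).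
Proof.
case/connectP=> p; elim: p a => [|c p IHp] a /=.
  by move=> _ ->; rewrite connect0.
case/andP=> Xac /IHp{}IHp /IHp.
have ac : connect (double_cover X) (inl a) (inr c) by apply: connect1.
by case/orP=> /double_cover_connect_swap /(connect_trans ac) ->; rewrite ?orbT.
Qed.

Lemma bipartite_odd_trace0 X :
  (forall k, odd k -> \tr (adjmx R X ^+ k) = 0) -> bipartite X.
Proof.
move=> tr0; have csym := sym_connect_sym (@adj_sym _ X).
have dsym := sym_connect_sym (@adj_sym _ (double_cover X)).
(* In each component, the colour class consists of the vertices whose x-lift is reachable from the
   x-lift of the root. *)
exists [set v | connect (double_cover X) (inl (fingraph.root X v)) (inl v)] => u v Xuv.
rewrite !inE.
have -> : fingraph.root X v = fingraph.root X u by apply/esym/(fingraph.rootP csym)/connect1.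
set r := fingraph.root X u.
have ru : connect X r u by rewrite csym connect_root.
have euv : connect (double_cover X) (inl u) (inr v) by apply: connect1.
have evu : connect (double_cover X) (inr u) (inl v).
  by apply: connect1; rewrite /= adj_sym.
have [cu|ncu] := boolP (connect _ _ (inl u)); last first.
  (* Here the root reaches the y-lift of [u], hence the x-lift of its neighbour [v]: the colours
     differ. *)
  move: (double_cover_connect_lift ru); rewrite (negPf ncu) /= => cu.
  by rewrite (connect_trans cu evu).
apply/negP=> /eqP/esym cv.
(* If [u] and [v] both had the colour of the root, one could go from x_r to x_u, to y_v, and back to
   y_r by the swapped route. This projects to an odd closed walk at [r], and the corresponding trace
   would be positive. *)
have : connect (double_cover X) (inl r) (inr r).
  apply: connect_trans (connect_trans cu euv) _; rewrite dsym.
  exact: (double_cover_connect_swap cv).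
case/connectP=> p /double_cover_path[+ +] Ep; rewrite -Ep /= => gt0 /esym odd_p.
have := tr0 _ odd_p; rewrite /mxtrace (bigD1 (enum_rank r)) //=.
apply/eqP; rewrite gt_eqF // ltr_wpDr // sumr_ge0 // => i _.
exact: adjmx_expr_ge0.
Qed.

End GraphMatrices.

(** * Root multiplicities and grouping of equal eigenvalues *)

Lemma mup_prod_XsubC (K : fieldType) (I : finType) (d : I -> K) a :
  mup a (\prod_k ('X - (d k)%:P)) = #|[pred k | d k == a]|.
Proof.
have -> : \prod_k ('X - (d k)%:P) = \prod_(y <- [seq d k | k : I]) ('X - y%:P).
  by rewrite big_image.
by rewrite mu_prod_XsubC count_map -sum1_count big_enum_cond sum1_card.
Qed.

Lemma char_polyN_split (K : comNzRingType) n (A : 'M[K]_n) (d : 'I_n -> K) :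
  char_poly A = \prod_k ('X - (d k)%:P) ->
  char_poly (- A) = \prod_k ('X + (d k)%:P).
Proof.
move=> Ad; rewrite char_polyN Ad rmorph_prod /=.
rewrite -[n in (-1) ^+ n]card_ord -prodr_const -big_split /=.
apply: eq_bigr => k _.
by rewrite rmorphB /= comp_polyX comp_polyC mulN1r opprB opprK addrC.
Qed.

(** The multiset of the d_k is invariant under negation, so an odd power sum equals its own
    opposite. *)
Lemma sum_odd_expr_eq0 (K : numFieldType) n (d : 'I_n -> K) k :
  (forall a, mup a (\prod_k ('X + (d k)%:P)) = mup a (\prod_k ('X - (d k)%:P))) ->
  odd k -> \sum_i d i ^+ k = 0.
Proof.
move=> mupE odd_k.
have perm_d : perm_eq [seq d i | i : 'I_n] [seq - d i | i : 'I_n].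
  apply/allP=> a _ /=; rewrite -!mu_prod_XsubC !big_image /=.
  rewrite -mupE; apply/eqP; congr mup; apply: eq_bigr => i _.
  by rewrite polyCN opprK.
have /eqP : \sum_i d i ^+ k = - \sum_i d i ^+ k.
  have {1}<- : \sum_(y <- [seq d i | i : 'I_n]) y ^+ k = \sum_i d i ^+ k.
    by rewrite big_image.
  rewrite (perm_big _ perm_d) big_image /=.
  by rewrite -sumrN; apply: eq_bigr => i _; rewrite exprNn -signr_odd odd_k mulN1r.
by rewrite -addr_eq0 -mulr2n mulrn_eq0 => /eqP.
Qed.

Lemma prod_fibers (K : comNzRingType) (I J : finType) (f : I -> J)
    (g : J -> K) :
  \prod_k g (f k) = \prod_i g i ^+ #|[pred k | f k == i]|.
Proof.
rewrite (partition_big f predT) //=; apply: eq_bigr => i _.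
by rewrite (eq_bigr (fun=> g i)) => [|k /eqP -> //]; rewrite prodr_const.
Qed.

(** The map [f] sends an index to the label of its distinct eigenvalue. Omitting one factor [y k]
    amounts to omitting [x (f k)] once, so the power with exponents mu_i - 1 divides every term. *)
Lemma bordered_fibers (K : idomainType) (I J : finType) (f : I -> J)
    (x : J -> K) (y c : I -> K) (z : K) (mu : J -> nat) :
  (forall k, x (f k) = y k) -> (forall i, x i != 0) ->
  (forall i, mu i = #|[pred k | f k == i]|) -> (forall i, (0 < mu i)%N) ->
  z * \prod_k y k - \sum_k c k * \prod_(l | l != k) y l =
  \prod_i x i ^+ (mu i - 1) *
  (z * \prod_i x i
   - \sum_i (\sum_(k | f k == i) c k) * \prod_(l | l != i) x l).
Proof.
move=> xE x0 muE mu_gt0; set q := \prod_i x i ^+ (mu i - 1).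
have Ep : \prod_k y k = q * \prod_i x i.
  rewrite -(eq_bigr _ (fun k _ => xE k)) prod_fibers -big_split.
  by apply: eq_bigr => i _ /=; rewrite -exprSr subn1 -muE prednK.
have Ew k : \prod_(l | l != k) y l = q * \prod_(l | l != f k) x l.
  apply: (mulfI (x0 (f k))); rewrite [RHS]mulrCA.
  have <- : \prod_i x i = x (f k) * \prod_(l | l != f k) x l.
    by rewrite (bigD1 (f k)).
  by rewrite -Ep xE [RHS](bigD1 k).
rewrite mulrBr Ep mulrCA; congr (_ - _).
rewrite (partition_big f predT) //= mulr_sumr; apply: eq_bigr => i _.
rewrite mulr_suml mulr_sumr; apply: eq_bigr => k /eqP <-.
by rewrite Ew mulrCA.
Qed.

(** Up to sign P_(-M)(x) is P_M(-x), so in P_M P_(-M) the factors P_A(x) and P_A(-x) both occur;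
    exchanging [A] for [- A] only swaps them, with sign (-1)^(2q) = 1. *)
Lemma char_poly_sqr_twist (K : comNzRingType) p q (M N : 'M[K]_p)
    (A : 'M[K]_q) (b : {poly K}) :
  char_poly M = char_poly A * b -> char_poly N = char_poly (- A) * b ->
  char_poly (M *m M) = char_poly (N *m N).
Proof.
move=> EM EN; apply: char_poly_sqr_eq; rewrite !char_polyN EM EN char_polyN.
have NNX (r : {poly K}) : (r \Po - 'X) \Po - 'X = r.
  by rewrite -comp_polyA rmorphN /= comp_polyX opprK comp_polyXr.
rewrite !rmorphM rmorphXn rmorphN1 /= NNX.
have e2 : (-1) ^+ q * (-1) ^+ q = 1 :> {poly K} by rewrite -expr2 sqrr_sign.
rewrite -[LHS]mul1r -{1}e2; ring.
Qed.

(** * Factorisations and spectra of the two extended graphs *)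

Theorem theorem4p3 (R : realType) (n : nat) (hn : (3 <= n)%N)
    (F : sgraph 'I_n) (hF : ~ bipartite F)
    (m : nat) (lam : 'I_m -> R) (mu : 'I_m -> nat)
    (lam_inj : injective lam)
    (lam_eig : forall a : R, eigenvalue (adjmx R F) a <-> exists i, lam i = a)
    (mu_mult : forall i, mu i = eig_mult (adjmx R F) (lam i))
    (j : nat) (hj : (1 <= j <= n)%N) :
  (exists rho : 'I_m -> R,
     let Q : {poly R} :=
       'X * \prod_(i < m) ('X - (lam i)%:P)
       - \sum_(i < m) (rho i ^+ 2) *: \prod_(l < m | l != i) ('X - (lam l)%:P) in
     graph_poly R (Hw F j)
       = \prod_(i < m) ('X - (lam i)%:P) ^+ (2 * mu i - 1) * Q
     /\
     graph_poly R (Gv F j)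
       = \prod_(i < m) ('X - (lam i)%:P) ^+ (mu i - 1)
         * \prod_(i < m) ('X + (lam i)%:P) ^+ mu i * Q)
  /\ singularly_cospectral R (Gv F j) (Hw F j)
  /\ ~ cospectral R (Gv F j) (Hw F j).
Proof.
pose S := [set i : 'I_n | (i < j)%N].
have Epairs : first_pairs n j = double_set S.
  by apply/setP=> -[i|i]; rewrite !inE.
have EH := graph_poly_two_copies R F S; rewrite -Epairs -/(Hw F j) in EH.
have EG := graph_poly_double_cover R F S; rewrite -Epairs -/(Gv F j) in EG.
move: EH EG; set A := adjmx R F; set B := block_mx _ _ _ _ => EH EG.
have [d [t [Ad Bd trA]]] := sym_spectral (indicator R S) 2%:R (tr_adjmx R F).
have NAd := char_polyN_split Ad.
have monic0 k (M : 'M[R]_k) : char_poly M != 0.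
  by rewrite monic_neq0 ?char_poly_monic.
split; last split.
- have /fin_all_exists[f fE] : forall k, exists i, lam i = d k.
    move=> k; apply/lam_eig; rewrite eigenvalue_root_char Ad.
    rewrite rootE horner_prod; apply/prodf_eq0; exists k => //.
    by rewrite hornerXsubC subrr.
  have muE i : mu i = #|[pred k | f k == i]|.
    rewrite mu_mult /eig_mult Ad mup_prod_XsubC; apply: eq_card => k.
    by rewrite !inE -fE (inj_eq lam_inj).
  have mu_gt0 i : (0 < mu i)%N.
    rewrite mu_mult /eig_mult -XsubC_dvd // dvdp_XsubCl -eigenvalue_root_char.
    by apply/lam_eig; exists i.
  have EA : char_poly A = \prod_i ('X - (lam i)%:P) ^+ mu i.
    rewrite Ad (eq_bigr (fun k => 'X - (lam (f k))%:P)) => [|k _].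
      rewrite (prod_fibers f (fun i => 'X - (lam i)%:P)).
      by apply: eq_bigr => i _; rewrite muE.
    by rewrite fE.
  have ENA : char_poly (- A) = \prod_i ('X + (lam i)%:P) ^+ mu i.
    rewrite NAd (eq_bigr (fun k => 'X + (lam (f k))%:P)) => [|k _].
      rewrite (prod_fibers f (fun i => 'X + (lam i)%:P)).
      by apply: eq_bigr => i _; rewrite muE.
    by rewrite fE.
  (* The weights 2 t_k^2 belonging to one eigenvalue are added; the sum is nonnegative, so it is the
     square of a real number. *)
  exists (fun i => Num.sqrt (\sum_(k | f k == i) 2%:R * t k ^+ 2)) => Q.
  have EB : char_poly B = \prod_i ('X - (lam i)%:P) ^+ (mu i - 1) * Q.
    rewrite Bd; under [X in _ - X]eq_bigr do rewrite -mul_polyC.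
    rewrite (@bordered_fibers _ _ _ f (fun i => 'X - (lam i)%:P)
              _ _ _ mu) => [|k|i||] //; last 2 first.
    + by rewrite fE.
    + by rewrite polyXsubC_eq0.
    congr (_ * (_ - _)); apply: eq_bigr => i _.
    rewrite sqr_sqrtr; last by rewrite sumr_ge0 // => k _;
      rewrite mulr_ge0 ?ler0n ?sqr_ge0.
    by rewrite -rmorph_sum /= mul_polyC.
  split.
    rewrite EH EA EB mulrA -big_split /=; congr (_ * _); apply: eq_bigr => i _.
    (* The exponents mu_i and mu_i - 1 add up to 2 mu_i - 1 in natural numbers because mu_i is
       positive. *)
    by rewrite -exprD addnBA // addnn mul2n.
  by rewrite EG ENA EB mulrCA mulrA.
(* By symmetry A^T A is the square of the adjacency matrix. *)
- move=> s _; rewrite /sing_mult !tr_adjmx /eig_mult.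
  by rewrite (char_poly_sqr_twist EH EG).
- move=> cosp; apply: hF; apply: (@bipartite_odd_trace0 R) => k odd_k.
  rewrite trA; apply: sum_odd_expr_eq0 odd_k => a; rewrite -Ad -NAd.
  (* The common nonzero factor P_B contributes equally to both multiplicities; cancelling it leaves
     equal multiplicities of [a] for [- A] and [A]. *)
  have := cosp a; rewrite /eig_mult -![char_poly (adjmx _ _)]/(graph_poly _ _).
  by rewrite EG EH !mupM //; apply: addIn.
Qed.
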